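(* Let $G$ be a connected graph and let $W\subseteq V(G)$ be a set of pairwise true twins in $G$ with $|W|\geq 2$. Let $S=E(G[W])$ be the set of edges of $G$ with both endpoints in $W$, and $G-S$ the graph obtained from $G$ by deleting these edges. Then \[\operatorname{diam}(\mathcal{R}(G))-\binom{|W|}{2}\leq \operatorname{diam}(\mathcal{R}(G-S)).\]
   Context: Two vertices $u,v$ are true twins if $N[u]=N[v]$ (closed neighbourhoods). For a connected graph $G$, a search tree on $G$ is a rooted tree with vertex set $V(G)$ defined recursively: its root is some vertex $r\in V(G)$, and the children of $r$ are the roots of search trees on the connected components of $G-r$. For a rooted tree $T$ and $w\in V(T)$, $T|w$ denotes the subtree rooted at $w$. Let $T$ be a search tree on $G$, let $v$ be a child of $u$ in $T$, and let $p$ be the parent of $u$ (if it exists). The $uv$-rotation transforms $T$ into the search tree $T'$ in which: $u$ is a child of $v$ and $v$ is a child of $p$ (or $v$ is the root if $u$ was the root); every subtree of $u$ in $T$ other than $T|v$ is a subtree of $u$ in $T'$; and every subtree $S$ of $v$ in $T$ is a subtree of $u$ in $T'$ if $u$ is adjacent in $G$ to some vertex of $S$, and a subtree of $v$ in $T'$ otherwise. The rotation graph $\mathcal{R}(G)$ is the graph whose vertices are the search trees on $G$, two being adjacent iff they differ by one rotation. $\operatorname{diam}$ denotes graph diameter. *)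

(* Defs.v *)
From mathcomp Require Import all_boot.
Set Implicit Arguments. Unset Strict Implicit. Unset Printing Implicit Defensive.

(* A simple graph G: a finite vertex type T with an edge relation e
   (assumed symmetric and irreflexive in the theorem). *)
Section Graphs.
Variable T : finType.
Variable e : rel T.

Definition connected_graph : Prop := forall x y : T, connect e x y.

Definition closed_nbhd (u : T) : {set T} := [set x | (x == u) || e u x].

Definition true_twins (u v : T) : Prop := closed_nbhd u = closed_nbhd v.

Definition rel_in (C : {set T}) : rel T :=
  [rel x y | [&& e x y, x \in C & y \in C]].

Definition conn_in (C : {set T}) : bool :=
  [forall x in C, forall y in C, connect (rel_in C) x y].

Definition is_comp (U C : {set T}) : bool :=
  [&& C \subset U, C != set0, conn_in C &
      [forall x in C, forall y in U, e x y ==> (y \in C)]].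

(* Search trees / forests, represented by their parent function
   (par x = None iff x is a root).  [sf f U p par] says: for every
   connected component C of G[U], par restricted to C is a search tree on
   G[C] whose root c has parent p, i.e. par c = p and the restriction to
   C :\ c is (recursively) a search forest on G[C] - c whose roots have
   parent c.  The natural number f is only fuel for the recursion
   (f = #|T| is always enough, since the vertex set shrinks at each level). *)
Fixpoint sf (f : nat) (U : {set T}) (p : option T)
    (par : {ffun T -> option T}) : bool :=
  if f is f'.+1 then
    [forall C : {set T}, is_comp U C ==>
       [exists c in C, (par c == p) && sf f' (C :\ c) (Some c) par]]
  else U == set0.

Definition search_forest (par : {ffun T -> option T}) : bool :=
  sf #|T| [set: T] None par.

Definition subtree (par : {ffun T -> option T}) (w : T) : {set T} :=
  [set y | connect [rel a b | par b == Some a] w y].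

Definition rotate (par : {ffun T -> option T}) (u v : T)
    : {ffun T -> option T} :=
  [ffun x => if x == v then par u
             else if x == u then Some v
             else if par x == Some v then
               (if [exists y in subtree par x, e u y] then Some u else Some v)
             else par x].

Definition rotation (par par' : {ffun T -> option T}) : bool :=
  [exists u, exists v, (par v == Some u) && (par' == rotate par u v)].

Definition RG_vertices : {set {ffun T -> option T}} :=
  [set par | search_forest par].

Definition RG_adj (t t' : {ffun T -> option T}) : bool :=
  [&& t \in RG_vertices, t' \in RG_vertices & rotation t t' || rotation t' t].
End Graphs.

Section Diameter.
Variable F : finType.
Variable V : {set F}.
Variable adj : rel F.

Fixpoint walk (n : nat) (x y : F) : bool :=
  if n is m.+1 then [exists z in V, adj x z && walk m z y] else x == y.

(* distance: least n with a walk of length n (a shortest walk in V has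
   length < #|F|; unreachable pairs would get the value #|F|, which never
   happens for the connected rotation graphs considered here) *)
Definition dist (x y : F) : nat := find (fun n => walk n x y) (iota 0 #|F|).

Definition diam : nat := \max_(x in V) \max_(y in V) dist x y.
End Diameter.

Definition rot_diam (T : finType) (e : rel T) : nat :=
  diam (RG_vertices e) (RG_adj e).

Definition del_edges_in (T : finType) (e : rel T) (W : {set T}) : rel T :=
  [rel x y | e x y && ~~ ((x \in W) && (y \in W))].

(* Main.v *)
Require Import Defs.
From mathcomp Require Import all_boot perm.
(* A search forest on G is determined by the family D of the vertex sets of its
   subtrees, and two search forests differ by one rotation iff their families
   agree except that the subtree of v in one is the subtree of u in the other.
   Replacing every subtree contained in W by its root projects the search
   forests on G onto those on G - S.  Two forests with the same projection
   differ only in the order of a chain of twins at the bottom, hence are joined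
   by exchanges of consecutive twins, and every rotation on G - S lifts to a
   rotation on G between suitable preimages.  So a geodesic of length d on G - S
   lifts to a walk on G made of d rotations and some exchanges of twins.  An
   exchange of a and b is also the effect of the automorphism (a b); if the same
   pair is exchanged twice, both exchanges can be dropped after applying (a b)
   to the part of the walk in between.  Hence each pair of twins is exchanged at
   most once, and the walk has length at most d + binomial(|W|, 2). *)

Set Implicit Arguments. Unset Strict Implicit. Unset Printing Implicit Defensive.

(** * Families of subtree vertex sets *)

Section Tubings.
Variable T : finType.
Implicit Types (e : rel T) (D : {ffun T -> {set T}}) (par : {ffun T -> option T}).

(* [D x] stands for the vertex set of the subtree rooted at [x]. *)
Record tubing e D : Prop := Tubing {
  tub_refl x : x \in D x;
  tub_trans x y z : y \in D x -> z \in D y -> z \in D x;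
  tub_anti x y : y \in D x -> x \in D y -> x = y;
  tub_chain x y z : z \in D x -> z \in D y -> (y \in D x) || (x \in D y);
  tub_edge x y : e x y -> (y \in D x) || (x \in D y);
  tub_conn x : conn_in e (D x) }.

(** Nothing is asked of [D' u]: between tubings of a symmetric relation it is determined by the
    rest, by [flip_rotate]. In this form the relation is symmetric. *)
Definition flip D D' :=
  exists u v, [/\ u != v, forall z, z != u -> z != v -> D' z = D z & D' v = D u].

Lemma flip_sym D D' : flip D D' -> flip D' D.
Proof.
case=> u [v [uv off vu]]; exists v, u; split; rewrite 1?eq_sym // => z zv zu.
by rewrite off.
Qed.

Definition desc par : {ffun T -> {set T}} := [ffun x => subtree par x].

Lemma in_desc par x y :
  (y \in desc par x) = connect [rel a b | par b == Some a] x y.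
Proof. by rewrite ffunE inE. Qed.

(** A path from [x] to [y] inside [C] has a first step out of [A]. Edges are extracted from
    connectedness in this way throughout. *)
Lemma conn_in_crossing e (C A : {set T}) x y :
    conn_in e C -> x \in C -> y \in C -> x \in A -> y \notin A ->
  exists a b, [/\ a \in C :&: A, b \in C :\: A & e a b].
Proof.
move=> /forall_inP/(_ x) H xC yC xA yA.
have /connectP[p pth ylast] := (forall_inP (H xC)) y yC.
elim: p x xC xA pth ylast {H} => [|b p IH] x xC xA /= => [_ yx|/andP[/and3P[exb _ bC] pth] yl].
  by rewrite yx xA in yA.
have [bA|bA] := boolP (b \in A); first exact: IH bA pth yl.
by exists x, b; rewrite !inE bA xC xA bC.
Qed.

Lemma conn_in_sub e e' C : subrel e e' -> conn_in e C -> conn_in e' C.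
Proof.
move=> ee' H; apply/forall_inP=> x xC; apply/forall_inP=> y yC.
have := forall_inP (forall_inP H x xC) y yC.
apply: connect_sub => a b /and3P[eab aC bC]; apply: connect1.
by apply/and3P; split=> //; apply: ee'.
Qed.

Lemma conn_in1 e x : conn_in e [set x].
Proof.
by apply/forall_inP=> a /set1P->; apply/forall_inP=> b /set1P->.
Qed.

Lemma connect_last (r : rel T) x y :
  connect r x y -> x = y \/ exists2 z, connect r x z & r z y.
Proof.
case/connectP=> p; elim/last_ind: p => [_ ->|p z _]; first by left.
rewrite rcons_path last_rcons => /andP[pth rz] ->; right.
by exists (last x p) => //; apply/connectP; exists p.
Qed.

Lemma connect_ind_last (r : rel T) x (P : T -> Prop) :
    P x -> (forall a b, connect r x a -> P a -> r a b -> P b) ->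
  forall y, connect r x y -> P y.
Proof.
move=> Px Pst y /connectP[p]; elim/last_ind: p y => [y _ ->//|p z IH y].
rewrite rcons_path last_rcons => /andP[pth rz] ->.
by apply: (Pst (last x p)) rz; [apply/connectP; exists p|apply: IH].
Qed.

Lemma desc_chain par x y z : z \in desc par x -> z \in desc par y ->
  (y \in desc par x) || (x \in desc par y).
Proof.
rewrite !in_desc; move=> zx; move: z zx y; apply: connect_ind_last.
  by move=> y ->; rewrite orbT.
move=> a b xa IH /= /eqP pb y /connect_last[->|[c yc /= /eqP]].
  by rewrite (connect_trans xa) //= connect1 //= pb.
by rewrite pb => -[ca]; apply: IH; rewrite ca.
Qed.

(** * Recovering parents from subtree sets *)

(** The parent relation in terms of subtree sets alone: [x] is the lowest proper ancestor of [y]. *)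
Definition imm D x y :=
  [&& x != y, y \in D x & [forall z, (z != y) && (y \in D z) ==> (x \in D z)]].

Lemma immP D x y : reflect [/\ x != y, y \in D x &
    forall z, z != y -> y \in D z -> x \in D z] (imm D x y).
Proof.
apply: (iffP and3P) => -[xy yx H]; split=> //.
  by move=> z zy yz; have /forallP/(_ z) := H; rewrite zy yz.
by apply/forallP=> z; apply/implyP=> /andP[]; apply: H.
Qed.

(** A loop [par x = Some x] gives the same subtree sets as [par x = None], so it must be excluded
    before [par] can be recovered from [desc par]. *)
Definition loopless par := forall x, par x != Some x.

Lemma par_imm e par x y : tubing e (desc par) -> loopless par ->
  (par y == Some x) = imm (desc par) x y.
Proof.
move=> tD nl; apply/eqP/immP => [py|[xy yx H]].
  split; first by apply: contra_eq_neq py => ->; apply: nl.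
    by rewrite in_desc connect1 //= py.
  move=> z zy; rewrite !in_desc => /connect_last[/eqP|[w zw /= /eqP]].
    by rewrite (negPf zy).
  by rewrite py => -[->].
move: (yx); rewrite in_desc => /connect_last[/eqP|[w xw /= /eqP py]].
  by rewrite (negPf xy).
rewrite py; congr Some; apply: (tub_anti tD); last by rewrite in_desc.
by apply: H; [apply: contraNneq (nl y) => E; rewrite py E|rewrite in_desc connect1 //= py].
Qed.

Lemma par_inj e par par' : tubing e (desc par) -> loopless par ->
  loopless par' -> desc par = desc par' -> par = par'.
Proof.
move=> tD nl nl' E; apply/ffunP=> y.
have H x : (par y == Some x) = (par' y == Some x).
  by rewrite (par_imm _ _ tD nl) E (@par_imm e) // -E.
case: (par y) H => [x|] H; first by apply/esym/eqP; rewrite -H.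
by case: (par' y) H => // x /(_ x); rewrite eqxx.
Qed.

(** [D u] is connected, so some edge inside it leaves [D x]. The outer end of that edge is
    comparable with the inner one, hence is an ancestor of [x]; lying in [D u], it can only be
    [u]. *)
Lemma imm_edge e D x u : symmetric e -> tubing e D -> imm D u x ->
  exists2 y, y \in D x & e u y.
Proof.
move=> es tD /immP[ux xu H].
have ux' : u \notin D x.
  by apply: contra_neqN ux => ?; apply: (tub_anti tD).
have [y [y' [/setIP[_ yx] /setDP[y'u y'x] ey]]] :=
  conn_in_crossing (tub_conn tD u) xu (tub_refl tD u) (tub_refl tD x) ux'.
exists y => //; suff -> : u = y' by rewrite es.
have yy' : y \in D y'.
  case/orP: (tub_edge tD ey) => // /(tub_trans tD yx); by rewrite (negPf y'x).
have xy' : x \in D y'.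
  by case/orP: (tub_chain tD yx yy') => //; rewrite (negPf y'x).
apply: (tub_anti tD y'u); apply: H => //.
by apply: contraNneq y'x => ->; apply: tub_refl tD _.
Qed.

Lemma tub_lt e D x y : tubing e D -> y \in D x -> x != y -> #|D y| < #|D x|.
Proof.
move=> tD yx xy; apply/proper_card/properP; split.
  by apply/subsetP=> z; apply: (tub_trans tD).
exists x; first exact: tub_refl tD x.
by apply: contra_neqN xy => ?; apply: (tub_anti tD).
Qed.

Lemma imm_ex e D x y : tubing e D -> y \in D x -> x != y ->
  exists2 p, imm D p y & p \in D x.
Proof.
move=> tD yx xy.
have Px : (x != y) && (y \in D x) by rewrite xy.
case: (@arg_minnP _ x (fun z => (z != y) && (y \in D z)) (fun z => #|D z|) Px) => p /andP[py yp] min.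
have H z : z != y -> y \in D z -> p \in D z.
  move=> zy yz; case/orP: (tub_chain tD yz yp) => // zp.
  have [->|pz] := eqVneq z p; first exact: tub_refl tD p.
  have := min z; rewrite zy yz leqNgt (tub_lt tD zp) 1?eq_sym //.
  by move/(_ isT).
by exists p; [apply/immP|apply: H].
Qed.

Lemma imm_uniq e D p q y : tubing e D -> imm D p y -> imm D q y -> p = q.
Proof.
move=> tD /immP[py yp Hp] /immP[qy yq Hq].
by apply: (tub_anti tD); [apply: Hq|apply: Hp].
Qed.

Definition par_of D : {ffun T -> option T} := [ffun y => [pick x | imm D x y]].

Lemma par_ofE e D x y : tubing e D -> (par_of D y == Some x) = imm D x y.
Proof.
move=> tD; rewrite ffunE; case: pickP => [p ip|no]; last by rewrite no.
apply/eqP/idP => [[<-]//|ix]; congr Some; exact: (imm_uniq tD ip ix).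
Qed.

Lemma par_of_loopless e D : tubing e D -> loopless (par_of D).
Proof. by move=> tD x; rewrite (par_ofE _ _ tD) /imm eqxx. Qed.

Lemma desc_par_of e D : tubing e D -> desc (par_of D) = D.
Proof.
move=> tD; apply/ffunP=> x; apply/setP=> y; rewrite in_desc; apply/idP/idP.
  move: y; apply: connect_ind_last; first exact: tub_refl tD x.
  move=> a b _ ax /=; rewrite (par_ofE _ _ tD) => /immP[_ ba _].
  exact: (tub_trans tD ax ba).
(* Climbing from [y] to [x] by parents passes through ever larger sets, so [#|T| - #|D y|]
   decreases. *)
have [n] := ubnP (#|T| - #|D y|); elim: n y => // n IH y lt yx.
have [->//|xy] := eqVneq x y.
have [p ip px] := imm_ex tD yx xy.
apply: (@connect_trans _ _ p); last by rewrite connect1 //= (par_ofE _ _ tD).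
apply: IH px; case/immP: ip => py yp _.
have l1 := tub_lt tD yp py.
rewrite ltnS in lt; apply: leq_trans lt; apply: ltn_sub2l => //.
exact: leq_trans l1 (max_card _).
Qed.

(** * Search forests are the tubings *)

(** The root of a component [C] of [U] is its vertex [c] with the largest set, and [C] equals [D c].
    Both conditions on [U] pass to [C :\ c], with [c] in place of [p]. *)
Lemma tubing_sf e D f (U : {set T}) p : symmetric e -> tubing e D -> #|U| <= f ->
    (forall x, x \in U -> D x \subset U) ->
    (forall x, x \in U -> par_of D x = p \/ exists2 q, q \in U & par_of D x = Some q) ->
  sf e f U p (par_of D).
Proof.
move=> es tD; elim: f U p => [|f IH] U p.
  by rewrite leqn0 cards_eq0.
move=> lt dn rt /=; apply/forallP=> C; apply/implyP=> /and4P[/subsetP CU /set0Pn[c0 c0C] cC clC].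
have cl x y : x \in C -> y \in U -> e x y -> y \in C.
  by move=> xC yU; apply/implyP/(forall_inP (forall_inP clC x xC)).
case: (@arg_maxnP _ c0 (fun z => z \in C) (fun z => #|D z|) c0C) => c cinC max.
have DC x : x \in C -> D x \subset C.
  move=> xC; apply/subsetP=> y yx; apply/negPn/negP=> yC.
  have [a [b [/setIP[_ aC] /setDP[bx bC] eab]]] :=
    conn_in_crossing (tub_conn tD x) (tub_refl tD x) yx xC yC.
  by rewrite (cl a b aC _ eab) // in bC; apply: (subsetP (dn x (CU x xC))).
have CD : C = D c.
  apply/eqP; rewrite eqEsubset DC // andbT; apply/subsetP=> y yC.
  apply/negPn/negP=> yc.
  have [a [b [/setIP[_ ac] /setDP[bC bc] eab]]] :=
    conn_in_crossing cC cinC yC (tub_refl tD c) yc.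
  have ab : a \in D b.
    by case/orP: (tub_edge tD eab) => // /(tub_trans tD ac); rewrite (negPf bc).
  have cb : c \in D b.
    by case/orP: (tub_chain tD ac ab) => //; rewrite (negPf bc).
  have := max b bC; rewrite /geq /= leqNgt (tub_lt tD cb) //.
  by apply: contraNneq bc => ->; apply: tub_refl tD c.
apply/existsP; exists c; rewrite cinC /=; apply/andP; split.
  case: (rt c (CU c cinC)) => [->//|[q qU /eqP]].
  rewrite (par_ofE _ _ tD) => /immP[qc cq _]; case: notF.
  suff qC : q \in C by have := max q qC; rewrite /geq /= leqNgt (tub_lt tD cq).
  apply/negPn/negP=> qC.
  have [a [b [/setIP[_ aC] /setDP[bx bC] eab]]] :=
    conn_in_crossing (tub_conn tD q) cq (tub_refl tD q) cinC qC.
  by rewrite (cl a b aC _ eab) // in bC; apply: (subsetP (dn q qU)).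
apply: IH.
- by have := subset_leq_card (introT subsetP CU); rewrite (cardsD1 c C) cinC => /leq_trans/(_ lt).
- move=> x /setD1P[xc xC]; apply/subsetP=> y yx; rewrite !inE (subsetP (DC x xC)) // andbT.
  apply: contra_neqN xc => /eqP E; apply: (tub_anti tD); first by rewrite -E.
  by rewrite -CD.
- move=> x /setD1P[xc xC].
  have xDc : x \in D c by rewrite -CD.
  have [q iq qc] := imm_ex tD xDc (introN eqP (fun E => elimN eqP xc (esym E))).
  have pq : par_of D x = Some q by apply/eqP; rewrite (par_ofE _ _ tD).
  have [E|qnc] := eqVneq q c; first by left; rewrite pq E.
  by right; exists q => //; rewrite !inE qnc CD.
Qed.

Lemma tubing_search_forest e D : symmetric e -> tubing e D ->
  search_forest e (par_of D).
Proof.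
move=> es tD; apply: tubing_sf => //; first by rewrite cardsT.
move=> x _; case E: (par_of D x) => [q|]; last by left.
by right; exists q; rewrite ?inE.
Qed.

Lemma comp_of e (U : {set T}) x : symmetric e -> x \in U ->
  exists2 C, is_comp e U C & x \in C.
Proof.
move=> es xU; pose r := rel_in e U; pose C := [set y | connect r x y].
have xC : x \in C by rewrite inE.
have CU : C \subset U.
  by apply/subsetP=> y; rewrite inE => /connect_last[<-//|[z _ /and3P[]]].
exists C => //; apply/and4P; split=> //; first by apply/set0Pn; exists x.
  have H y : y \in C -> connect (rel_in e C) x y.
    rewrite inE; move: y; apply: connect_ind_last => // a b xa IH rab.
    apply: connect_trans IH _; apply: connect1; have /and3P[eab _ _] := rab.
    by rewrite /rel_in /= eab !inE xa (connect_trans xa (connect1 rab)).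
  have rCs : connect_sym (rel_in e C).
    apply: sym_connect_sym => a b; rewrite /rel_in /= es; congr (_ && _); exact: andbC.
  apply/forall_inP=> a aC; apply/forall_inP=> b bC.
  by apply: connect_trans (H b bC); rewrite rCs H.
apply/forall_inP=> a; rewrite inE => xa; apply/forall_inP=> b bU.
apply/implyP=> eab; rewrite inE (connect_trans xa) // connect1 // /r /rel_in /= eab bU.
by rewrite (subsetP CU) // inE.
Qed.

(* The hypothesis on [p] (no ancestor of [p] lies in [U]) makes the global
   relation [desc par] agree with descent inside [U]. *)
Lemma sf_desc e par f (U : {set T}) p : symmetric e ->
    sf e f U p par ->
    (forall q z, p = Some q -> q \in desc par z -> z \notin U) ->
  [/\ forall y, y \in U -> exists r, [/\ r \in U, par r = p & y \in desc par r],
      forall x y, x \in U -> y \in U -> e x y ->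
        (y \in desc par x) || (x \in desc par y),
      forall x, x \in U -> conn_in e (desc par x :&: U),
      forall x, x \in U -> par x != Some x &
      forall x y, x \in U -> y \in U -> y \in desc par x -> x \in desc par y ->
        x = y].
Proof.
move=> es; elim: f U p => [|f IH] U p /=.
  by move=> /eqP-> _; split=> x; rewrite inE.
move=> /forallP sfU pU.
(* Any proper ancestor of a root [c] is [p] or lies above [p], hence is outside [U]. *)
have root_top c z : c \in U -> par c = p -> z \in U -> c \in desc par z -> z = c.
  move=> cU pc zU; rewrite in_desc => /connect_last[//|[q zq /= /eqP]].
  rewrite pc => pq; have := pU q z pq; rewrite in_desc zU => /(_ zq) //.
have key x : x \in U -> exists C c, [/\ is_comp e U C, x \in C, c \in C,
    par c = p & [/\ sf e f (C :\ c) (Some c) par,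
      (forall q z, Some c = Some q -> q \in desc par z -> z \notin C :\ c)
      & forall y, y \in C -> y \in desc par c]].
  move=> xU; have [C cC xC] := comp_of es xU.
  have /existsP[c /and3P[cinC /eqP pc sfc]] := implyP (sfU C) cC.
  have cU : c \in U by case/and4P: cC => /subsetP/(_ c cinC).
  have H q z : Some c = Some q -> q \in desc par z -> z \notin C :\ c.
    move=> [<-] cz; rewrite !inE negb_and negbK -implyNb; apply/implyP=> zc.
    apply: contra zc => zC; apply/eqP; apply: root_top pc _ cz => //.
    by case/and4P: cC => /subsetP/(_ z zC).
  exists C, c; split=> //; split=> // y yC; have [->|yc] := eqVneq y c.
    by rewrite in_desc.
  have [/(_ y)] := IH _ _ sfc H; rewrite !inE yc yC => /(_ isT)[r [_ pr yr]] _ _ _ _.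
  rewrite in_desc; apply: (@connect_trans _ _ r); last by rewrite -in_desc.
  by rewrite connect1 //= pr.
(* The root of the component of [y] is comparable with [c], hence equal to it by [root_top]. That
   component is connected and meets [C], so it cannot leave [C]. *)
have descU C c y : is_comp e U C -> c \in C -> par c = p -> y \in U ->
    y \in desc par c -> y \in C.
  move=> cC cinC pc yU yc.
  have cU : c \in U by case/and4P: cC => /subsetP/(_ c cinC).
  have [C' [c' [cC' yC' c'C' pc' [_ _ H]]]] := key y yU.
  have c'U : c' \in U by case/and4P: cC' => /subsetP/(_ c' c'C').
  have cc' : c = c'.
    case/orP: (desc_chain yc (H y yC')) => h; first exact: root_top h.
    by apply/esym; apply: root_top h.
  have yDc' : C' \subset C.
    apply/subsetP=> z zC'; apply/negPn/negP=> zC.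
    have conC' : conn_in e C' by case/and4P: cC'.
    have [a [b [/setIP[_ aC] /setDP[bC' bC] eab]]] :=
      conn_in_crossing conC' c'C' zC' (etrans (congr1 (mem C) (esym cc')) cinC) zC.
    case/and4P: cC => _ _ _ /forall_inP/(_ a aC)/forall_inP/(_ b).
    have -> : b \in U by case/and4P: cC' => /subsetP/(_ b bC').
    by rewrite eab (negPf bC) => /(_ isT).
  exact: (subsetP yDc').
split.
- move=> y yU; have [C [c [cC yC cinC pc [_ _ H]]]] := key y yU.
  exists c; split=> //; last exact: H.
  by case/and4P: cC => /subsetP/(_ c cinC).
- move=> x y xU yU exy; have [C [c [cC xC cinC pc [sfc pcC H]]]] := key x xU.
  have yC : y \in C.
    by case/and4P: cC => _ _ _ /forall_inP/(_ x xC)/forall_inP/(_ y yU)/implyP/(_ exy).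
  have [->|xc] := eqVneq x c; first by rewrite H.
  have [->|yc] := eqVneq y c; first by rewrite H ?orbT.
  have [_ H2 _ _ _] := IH _ _ sfc pcC; apply: H2 => //; by rewrite !inE ?xc ?yc.
- move=> x xU; have [C [c [cC xC cinC pc [sfc pcC H]]]] := key x xU.
  have conC : conn_in e C by case/and4P: cC.
  have cU : c \in U by case/and4P: cC => /subsetP/(_ c cinC).
  have [->|xc] := eqVneq x c.
    suff -> : desc par c :&: U = C by [].
    apply/setP=> y; apply/setIP/idP => [[yc yU]|yC]; first exact: descU yc.
    by split; [apply: H|case/and4P: cC => /subsetP/(_ y yC)].
  suff -> : desc par x :&: U = desc par x :&: (C :\ c).
    by have [_ _ H3 _ _] := IH _ _ sfc pcC; apply: H3; rewrite !inE xc.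
  apply/setP=> y; rewrite !in_setI; case yx: (y \in desc par x) => //=.
  apply/idP/setD1P => [yU|[_ yC]]; last by case/and4P: cC => /subsetP/(_ y yC).
  split; first by apply: contra_neq xc => E; apply: root_top pc _ _ => //; rewrite -E.
  apply: descU cC cinC pc yU _; rewrite in_desc; apply: (@connect_trans _ _ x).
    by rewrite -in_desc H.
  by rewrite -in_desc.
- move=> x xU; have [C [c [cC xC cinC pc [sfc pcC H]]]] := key x xU.
  have [->|xc] := eqVneq x c; last first.
    by have [_ _ _ H4 _] := IH _ _ sfc pcC; apply: H4; rewrite !inE xc.
  apply/eqP; rewrite pc => pE; have := pU c c pE; rewrite in_desc connect0.
  by case/and4P: cC => /subsetP/(_ c cinC) -> _ _ _ /(_ isT).
- move=> x y xU yU yx xy; have [C [c [cC xC cinC pc [sfc pcC H]]]] := key x xU.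
  have cU : c \in U by case/and4P: cC => /subsetP/(_ c cinC).
  have [E|xc] := eqVneq x c.
    by apply/esym; rewrite E; apply: root_top => //; rewrite -E.
  have [E|yc] := eqVneq y c.
    by rewrite E; apply: root_top => //; rewrite -E.
  have [_ _ _ _ H5] := IH _ _ sfc pcC.
  apply: H5 => //; rewrite !inE ?xc ?yc //=.
  apply: descU cC cinC pc yU _; rewrite in_desc; apply: (@connect_trans _ _ x).
    by rewrite -in_desc H.
  by rewrite -in_desc.
Qed.

Lemma search_forest_tubing e par : symmetric e -> search_forest e par ->
  tubing e (desc par) /\ loopless par.
Proof.
move=> es sfp; have [//|_ H2 H3 H4 H5] := sf_desc es sfp.
split; last by move=> x; apply: H4; rewrite inE.
split.
- by move=> x; rewrite in_desc.
- by move=> x y z; rewrite !in_desc; apply: connect_trans.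
- by move=> x y; apply: H5; rewrite inE.
- by move=> x y z; apply: desc_chain.
- by move=> x y; apply: H2; rewrite inE.
- by move=> x; have := H3 x; rewrite setIT inE; apply.
Qed.

(** * Rotations are the flips *)

(** Whichever way the adjacency test goes, a child of [v] stays below [v], because [u] is now a
    child of [v]. So descent from vertices other than [u] and [v] is unchanged, and [v] takes over
    the subtree of [u]. *)
Lemma rotate_flip e par u v : par v = Some u -> u != v ->
  flip (desc par) (desc (rotate e par u v)).
Proof.
move=> pv uv; set par' := rotate e par u v.
have p'v : par' v = par u by rewrite ffunE eqxx.
have p'u : par' u = Some v by rewrite ffunE (negPf uv) eqxx.
have p'c x : x != u -> x != v -> par x = Some v -> par' x = Some u \/ par' x = Some v.
  by move=> xu xv px; rewrite ffunE (negPf xu) (negPf xv) px eqxx; case: ifP; [left|right].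
have p'o x : x != u -> x != v -> par x <> Some v -> par' x = par x.
  by move=> xu xv /eqP/negPf px; rewrite ffunE (negPf xu) (negPf xv) px.
pose r := [rel a b | par b == Some a]; pose r' := [rel a b | par' b == Some a].
have st a b z : connect r z a -> par b = Some a -> connect r z b.
  by move=> za pb; apply: connect_trans za _; rewrite connect1 //= pb.
have st' a b z : connect r' z a -> par' b = Some a -> connect r' z b.
  by move=> za pb; apply: connect_trans za _; rewrite connect1 //= pb.
exists u, v; split=> // [z zu zv|]; apply/setP=> y; rewrite !in_desc -/r -/r'.
  apply/idP/idP; move: y; apply: connect_ind_last => // a b _ IH /= /eqP.
    have [->|bu] := eqVneq b u.
      rewrite p'u => -[av]; move: IH; rewrite -av.
      by case/connect_last=> [/eqP|[w zw /= /eqP]]; rewrite ?(negPf zv) // pv => -[->].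
    have [->|bv] := eqVneq b v; first by rewrite p'v => pu; apply: (st) pv; apply: (st) pu.
    have [pb|npb] := eqVneq (par b) (Some v); last by rewrite p'o //; [apply: (st)|apply/eqP].
    case: (p'c b bu bv pb) => -> [E]; rewrite -E in IH; last exact: (st) pb.
    by apply: (st) pb; apply: (st) pv.
  have [->|bu] := eqVneq b u.
    by move=> pu; apply: (st') p'u; apply: (st') IH _; rewrite p'v.
  have [->|bv] := eqVneq b v.
    rewrite pv => -[E]; move: IH; rewrite -E.
    by case/connect_last=> [/eqP|[w zw /= /eqP]]; rewrite ?(negPf zu) // p'u => -[->].
  have [pb|npb] := eqVneq (par b) (Some v).
    rewrite pb => -[E]; rewrite -E in IH.
    by case: (p'c b bu bv pb); apply: (st') => //; apply: (st') p'u.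
  by move=> pb; apply: (st') IH _; rewrite p'o //; apply/eqP.
apply/idP/idP; move: y; apply: connect_ind_last.
- exact: (st) (connect0 _ _) pv.
- move=> a b _ IH /= /eqP.
  have [->|bu] := eqVneq b u; first by [].
  have [->|bv] := eqVneq b v; first by move=> _; exact: (st) (connect0 _ _) pv.
  have [pb|npb] := eqVneq (par b) (Some v); last by rewrite p'o //; [apply: (st)|apply/eqP].
  by move=> _; apply: (st) pb; exact: (st) (connect0 _ _) pv.
- exact: (st') (connect0 _ _) p'u.
- move=> a b _ IH /= /eqP.
  have [->|bu] := eqVneq b u; first by move=> _; exact: (st') (connect0 _ _) p'u.
  have [->|bv] := eqVneq b v; first by [].
  have [pb|npb] := eqVneq (par b) (Some v).
    by move=> _; case: (p'c b bu bv pb); apply: (st') => //; exact: (st') (connect0 _ _) p'u.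
  by move=> pb; apply: (st') IH _; rewrite p'o //; apply/eqP.
Qed.

Lemma RG_adj_flip e par par' : symmetric e -> RG_adj e par par' ->
  flip (desc par) (desc par').
Proof.
move=> es /and3P[]; rewrite !inE => sf1 sf2.
have H p p' : search_forest e p -> rotation e p p' -> flip (desc p) (desc p').
  move=> /(search_forest_tubing es)[_ nl] /existsP[u /existsP[v /andP[/eqP pv /eqP->]]].
  by apply: rotate_flip => //; apply: contraNneq (nl v) => E; rewrite pv E.
by case/orP=> [|h]; [apply: H|apply: flip_sym; apply: H h].
Qed.

Section FlipRotation.
Variables (e : rel T) (par par' : {ffun T -> option T}) (u v : T).
Let D := desc par.
Let D' := desc par'.
Hypotheses (tD : tubing e D) (tD' : tubing e D').
Hypotheses (nl : loopless par) (nl' : loopless par').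
Hypotheses (uv : u != v) (off : forall z, z != u -> z != v -> D' z = D z).
Hypothesis vu : D' v = D u.

(** If [z] is neither [u] nor [v] and [D z] contains [v], then [D z] is [D' z] and contains [D' v],
    which is [D u]. So nothing lies between [u] and [v]. *)
Lemma flip_par_child : par v = Some u.
Proof.
apply/eqP; rewrite (par_imm _ _ tD nl) -/D; apply/immP; split=> //.
  by rewrite -vu (tub_refl tD').
move=> z zv vz; have [->|zu] := eqVneq z u; first exact: tub_refl tD u.
move: vz; rewrite -(off zu zv) => vz; apply: (tub_trans tD' vz).
by rewrite vu (tub_refl tD).
Qed.

Lemma flip_par_top w : par u = Some w -> par' v = Some w.
Proof.
move=> /eqP; rewrite (par_imm _ _ tD nl) -/D => /immP[wu uw H].
have vDu : v \in D u by rewrite -vu (tub_refl tD').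
have wv : w != v.
  by apply: contra_neq wu => E; apply: (tub_anti tD) => //; rewrite E.
apply/eqP; rewrite (par_imm _ _ tD' nl') -/D'; apply/immP; split=> //.
  by rewrite (off wu wv) (tub_trans tD uw).
move=> z zv vz; have zu : z != u.
  apply: contra_neq uv => E; apply: (tub_anti tD'); first by rewrite -E.
  by rewrite vu (tub_refl tD).
rewrite off //; apply: H => //; rewrite off // in vz.
have /eqP := flip_par_child; rewrite (par_imm _ _ tD nl) => /immP[_ _]; exact.
Qed.

End FlipRotation.

(** The families share all sets but those of [u] and [v], so each parent in [D'] can be computed
    through [imm]. The adjacency test of [rotate] comes from [tub_edge] in one direction and from
    [imm_edge] in the other. *)
Lemma flip_rotate e par par' u v : symmetric e ->
    tubing e (desc par) -> tubing e (desc par') -> loopless par -> loopless par' ->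
    u != v -> (forall z, z != u -> z != v -> desc par' z = desc par z) ->
    desc par' v = desc par u ->
  par v = Some u /\ par' = rotate e par u v.
Proof.
set D := desc par; set D' := desc par' => es tD tD' nl nl' uv off vu.
have off' z : z != v -> z != u -> D z = D' z by move=> zv zu; rewrite off.
have vu' : v != u by rewrite eq_sym.
have pv : par v = Some u by apply: (flip_par_child tD tD').
have p'u : par' u = Some v by apply: (flip_par_child tD' tD).
split=> //.
have im x y : par y = Some x -> imm D x y by move/eqP; rewrite (par_imm _ _ tD nl).
have im' x y : imm D' x y -> par' y = Some x by rewrite -(par_imm _ _ tD' nl') => /eqP.
have im'' x y : par' y = Some x -> imm D' x y by move/eqP; rewrite (par_imm _ _ tD' nl').
have /immP[_ vDu Hv] := im _ _ pv.
have /immP[_ uDv' _] := im'' _ _ p'u.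
have nvu : v \notin D' u by apply: contra_neqN uv => ?; apply: (tub_anti tD').
have D'u x : x \in D' u -> x \in D u.
  by move=> xu; rewrite -vu (tub_trans tD' uDv').
(* An edge from [u] into [D x] has its end below [u] in [D']; the chain condition in [D'] then puts
   [x] there too. *)
have adj x y : x != u -> x != v -> x \in D u -> y \in D x -> e u y -> x \in D' u.
  move=> xu xv xDu yx euy.
  have nux : u \notin D x by apply: contra_neqN xu => ?; apply: (tub_anti tD).
  have yu : y != u by apply: contraNneq nux => <-.
  have nuDy : u \notin D' y.
    have [E|yv] := eqVneq y v.
      have vx : v \in D x by rewrite -E.
      by have := Hv x xv vx; rewrite (negPf nux).
    rewrite off //; apply: contra nux; exact: (tub_trans tD yx).
  have yu' : y \in D' u by case/orP: (tub_edge tD' euy); rewrite ?(negPf nuDy).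
  have yx' : y \in D' x by rewrite off.
  by case/orP: (tub_chain tD' yu' yx') => //; rewrite off // (negPf nux).
apply/ffunP=> x; rewrite ffunE.
have [->|xv] := eqVneq x v.
  case E: (par u) => [w|]; first exact: (flip_par_top tD tD' nl nl' uv off vu).
  case E': (par' v) => [w|] //.
  by rewrite -E (flip_par_top tD' tD nl' nl vu' off' (esym vu) E').
have [->//|xu] := eqVneq x u.
have [px|npx] := eqVneq (par x) (Some v).
  have /immP[_ xDv Hx] := im _ _ px.
  have xDu : x \in D u by apply: (tub_trans tD vDu).
  have immu : x \in D' u -> imm D' u x.
    move=> xu'; apply/immP; split; rewrite 1?eq_sym // => z zx.
    have [-> _|zu] := eqVneq z u; first exact: tub_refl tD' u.
    have [-> _|zv] := eqVneq z v; first by [].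
    by rewrite off // => xz; apply: Hv => //; apply: Hx.
  case: ifP => [/existsP[y /andP[yx euy]]|/negbT nadj].
    by apply/im'/immu; apply: (adj x y) => //; rewrite /D ffunE.
  apply/im'/immP; split; rewrite 1?eq_sym ?vu // => z zx.
  have [-> xu'|zu] := eqVneq z u.
    have [y yx euy] := imm_edge es tD' (immu xu').
    case/existsP: nadj; exists y; rewrite euy andbT.
    by move: yx; rewrite off // /D ffunE.
  have [-> _|zv] := eqVneq z v; first exact: tub_refl tD' v.
  by rewrite off // => xz; apply: Hx.
case E: (par x) => [w|]; last first.
  case E': (par' x) => [w|] //; case/immP: (im'' _ _ E') => wx xw _.
  suff [z zx xz] : exists2 z, z != x & x \in D z.
    have [p] := imm_ex tD xz zx.
    by rewrite -(par_imm _ _ tD nl) E.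
  have ux : u != x by rewrite eq_sym.
  have [wu|wu] := eqVneq w u; first by exists u => //; apply: D'u; rewrite -wu.
  have [wv|wv] := eqVneq w v; first by exists u => //; rewrite -vu -wv.
  by exists w; rewrite // -off.
have wv : w != v by apply: contraNneq npx => <-; rewrite E.
have iw := im _ _ E; have /immP[wx xw Hw] := iw.
apply/im'; have [wu|wu] := eqVneq w u.
  (* The subtree of a child of [u] contains a neighbour of [u], so this child stays below [u]. *)
  rewrite wu in iw xw Hw wx *; have [y yx euy] := imm_edge es tD iw.
  apply/immP; split=> // [|z zx]; first exact: (adj x y).
  have [-> _|zu] := eqVneq z u; first exact: tub_refl tD' u.
  have [-> _|zv] := eqVneq z v; first by [].
  by rewrite off //; apply: Hw.
apply/immP; split=> // [|z zx]; first by rewrite off.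
have [-> xu'|zu] := eqVneq z u.
  have xw' : x \in D' w by rewrite off.
  case/orP: (tub_chain tD' xu' xw') => // uw.
  have wDu : w \in D u by apply: Hw; rewrite 1?eq_sym // D'u.
  rewrite off // in uw; by rewrite (tub_anti tD uw wDu) eqxx in wu.
have [->|zv] := eqVneq z v; first by rewrite vu => ?; apply: Hw; rewrite // eq_sym.
by rewrite off //; apply: Hw.
Qed.

Lemma flip_RG_adj e par par' : symmetric e ->
    search_forest e par -> search_forest e par' ->
  flip (desc par) (desc par') -> RG_adj e par par'.
Proof.
move=> es sf1 sf2 [u [v [uv off vu]]].
have [t1 l1] := search_forest_tubing es sf1.
have [t2 l2] := search_forest_tubing es sf2.
have [pv E] := flip_rotate es t1 t2 l1 l2 uv off vu.
rewrite /RG_adj !inE sf1 sf2 /=; apply/orP; left.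
by apply/existsP; exists u; apply/existsP; exists v; rewrite pv -E !eqxx.
Qed.

(** * Transpositions acting on families *)

(** The image of the family under the transposition of [a] and [b], acting on indices and elements
    alike. Taking preimages is right since a transposition is its own inverse. *)
Definition relabel (a b : T) D : {ffun T -> {set T}} :=
  [ffun x => [set y | tperm a b y \in D (tperm a b x)]].

Lemma in_relabel a b D x y :
  (y \in relabel a b D x) = (tperm a b y \in D (tperm a b x)).
Proof. by rewrite ffunE inE. Qed.

Lemma relabelK a b : involutive (relabel a b).
Proof.
by move=> D; apply/ffunP=> x; apply/setP=> y; rewrite !in_relabel !tpermK.
Qed.

Lemma relabelC a b D : relabel a b D = relabel b a D.
Proof. by rewrite /relabel tpermC. Qed.

(** Conjugation of transpositions. It shows that an exchange of twins, after renaming, is again an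
    exchange, of the renamed pair. *)
Lemma relabel_conj a b c d D :
  relabel a b (relabel c d D) =
  relabel (tperm a b c) (tperm a b d) (relabel a b D).
Proof.
have E z : tperm a b (tperm (tperm a b c) (tperm a b d) z) =
    tperm c d (tperm a b z).
  by rewrite (inj_tperm _ _ _ perm_inj) !tpermK.
by apply/ffunP=> x; apply/setP=> y; rewrite !in_relabel !E.
Qed.

Lemma relabel_flip a b D D' :
  flip D D' -> flip (relabel a b D) (relabel a b D').
Proof.
case=> u [v [uv off vu]]; exists (tperm a b u), (tperm a b v); split.
- by rewrite (inj_eq perm_inj).
- move=> z zu zv; apply/setP=> y; rewrite !in_relabel off //.
    by apply: contraNneq zu => <-; rewrite tpermK.
  by apply: contraNneq zv => <-; rewrite tpermK.
- by apply/setP=> y; rewrite !in_relabel !tpermK vu.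
Qed.

Lemma relabel_tubing e a b D :
    (forall x y, e (tperm a b x) (tperm a b y) = e x y) ->
  tubing e D -> tubing e (relabel a b D).
Proof.
move=> aut tD; split.
- by move=> x; rewrite in_relabel (tub_refl tD).
- by move=> x y z; rewrite !in_relabel; apply: (tub_trans tD).
- move=> x y; rewrite !in_relabel => h1 h2.
  exact: (perm_inj (tub_anti tD h1 h2)).
- by move=> x y z; rewrite !in_relabel; apply: (tub_chain tD).
- by move=> x y; rewrite !in_relabel -aut; apply: (tub_edge tD).
- move=> x; apply/forall_inP=> y yx; apply/forall_inP=> z.
  rewrite in_relabel => zx; rewrite in_relabel in yx.
  have := forall_inP (forall_inP (tub_conn tD (tperm a b x)) _ yx) _ zx.
  rewrite -{2}[z](tpermK a b); move: (tperm a b z).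
  apply: connect_ind_last; first by rewrite tpermK.
  move=> c d _ IH /and3P[ecd cx dx]; apply: connect_trans IH _.
  by apply: connect1; rewrite /rel_in /= aut ecd !in_relabel !tpermK cx dx.
Qed.

(** * True twins and the projection to [e'] *)

Section Twins.
Variables (e : rel T) (W : {set T}).
Hypotheses (es : symmetric e) (ei : irreflexive e).
Hypothesis tw : forall u v, u \in W -> v \in W -> true_twins e u v.
Let e' := del_edges_in e W.

Lemma twin_edge a b : a \in W -> b \in W -> a != b -> e a b.
Proof.
move=> aW bW ab; have /setP/(_ b) := tw aW bW.
by rewrite !inE eqxx eq_sym (negPf ab).
Qed.

Lemma twin_nbr a b z : a \in W -> b \in W -> z != a -> z != b -> e a z = e b z.
Proof.
move=> aW bW za zb; have /setP/(_ z) := tw aW bW.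
by rewrite !inE (negPf za) (negPf zb).
Qed.

Lemma twin_aut a b : a \in W -> b \in W ->
  forall x y, e (tperm a b x) (tperm a b y) = e x y.
Proof.
move=> aW bW x y; case: tpermP => [->|->|/eqP xa /eqP xb];
  case: tpermP => [->|->|/eqP ya /eqP yb]; rewrite ?ei //.
- exact: twin_nbr.
- exact: twin_nbr.
- by rewrite ![e x _]es; apply: twin_nbr.
- by rewrite ![e x _]es; apply: twin_nbr.
Qed.

Lemma del_sym : symmetric e'.
Proof. by move=> x y; rewrite /e' /del_edges_in /= es [(x \in W) && _]andbC. Qed.

Lemma del_notin x y : y \notin W -> e' x y = e x y.
Proof. by move=> yW; rewrite /e' /del_edges_in /= (negPf yW) andbF andbT. Qed.

Lemma del_indep x y : e' x y -> x \in W -> y \notin W.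
Proof. by case/andP=> _; case: (x \in W). Qed.

Lemma twin_comparable D x y : tubing e D -> x \in W -> y \in W ->
  (y \in D x) || (x \in D y).
Proof.
move=> tD xW yW; have [->|xy] := eqVneq x y; first by rewrite (tub_refl tD).
exact: (tub_edge tD (twin_edge xW yW xy)).
Qed.

(** [W] is independent for [e'], so a nonempty connected set inside [W] is a single vertex; this
    dictates the first case. *)
Definition flat D : {ffun T -> {set T}} :=
  [ffun x => if D x \subset W then [set x] else D x].

Lemma flat_sub D x : tubing e D -> flat D x \subset D x.
Proof. by move=> tD; rewrite ffunE; case: ifP; rewrite // sub1set (tub_refl tD). Qed.

(** If [C] meets [W], an edge inside [C] joins a twin to some [n] outside [W], and [n] is then
    adjacent to all twins. A deleted edge is replaced by the detour through [n]. *)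
Lemma conn_in_del (C : {set T}) :
  conn_in e C -> ~~ (C \subset W) -> conn_in e' C.
Proof.
move=> cC /subsetPn[z zC zW]; apply/forall_inP=> x xC; apply/forall_inP=> y yC.
have := forall_inP (forall_inP cC x xC) y yC; apply: connect_sub => a b.
case/and3P=> eab aC bC; case abW: ((a \in W) && (b \in W)); last first.
  by apply: connect1; rewrite /rel_in /e' /del_edges_in /= eab abW aC bC.
case/andP: abW => aW bW.
have [c [n [/setIP[_ cW] /setDP[nC nW] ecn]]] := conn_in_crossing cC aC zC aW zW.
have nb d : d \in W -> e d n.
  by move=> dW; rewrite (@twin_nbr d c) //; apply: contraNneq nW => ->.
apply: (@connect_trans _ _ n); apply: connect1; rewrite /rel_in /e' /del_edges_in /=.
  by rewrite aC nC nb // (negPf nW) andbF.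
by rewrite nC bC es nb // (negPf nW).
Qed.

Lemma flat_tubing D : tubing e D -> tubing e' (flat D).
Proof.
move=> tD; have subD x y : y \in flat D x -> y \in D x by apply/subsetP/flat_sub.
split.
- by move=> x; rewrite ffunE; case: ifP; rewrite ?inE // (tub_refl tD).
- move=> x y z; case Dx: (D x \subset W).
    by rewrite [flat D x]ffunE Dx => /set1P->; rewrite ffunE Dx.
  move=> /subD yx /subD zy; rewrite ffunE Dx; exact: (tub_trans tD yx).
- by move=> x y yx xy; apply: (tub_anti tD); apply: subD.
- move=> x y z zx zy; case Dx: (D x \subset W).
    by move: zx; rewrite [flat D x]ffunE Dx => /set1P E; rewrite -E zy orbT.
  case Dy: (D y \subset W).
    by move: zy; rewrite [flat D y]ffunE Dy => /set1P E; rewrite -E zx.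
  by rewrite !ffunE Dx Dy; apply: (tub_chain tD (subD _ _ zx) (subD _ _ zy)).
- move=> x y /andP[exy xyW]; have := tub_edge tD exy; rewrite !ffunE => H.
  wlog: x y exy xyW H / y \in D x.
    move=> G; case/orP: (H) => [|xy]; first exact: G.
    by rewrite orbC; apply: G; rewrite // 1?es // 1?andbC // orbC.
  move=> yx; suff /negPf-> : ~~ (D x \subset W) by rewrite yx.
  by apply: contra xyW => /subsetP Dx; rewrite !Dx // (tub_refl tD).
- move=> x; rewrite ffunE; case: ifPn => Dx; first exact: conn_in1.
  exact: (conn_in_del (tub_conn tD x) Dx).
Qed.

(** * Forests with the same projection *)

Definition inversions D1 D2 :=
  [set p : T * T | [&& p.1 != p.2, p.2 \in D1 p.1 & p.1 \in D2 p.2]].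

Section Fibre.
Variables D1 D2 : {ffun T -> {set T}}.
Hypotheses (t1 : tubing e D1) (t2 : tubing e D2) (fE : flat D1 = flat D2).

Lemma flat_eq_sub x : (D1 x \subset W) = (D2 x \subset W).
Proof.
have /ffunP/(_ x) := fE; rewrite !ffunE.
case: ifPn => h1; case: ifPn => h2 // E.
- by rewrite -E sub1set (subsetP h1) ?(tub_refl t1) in h2.
- by rewrite E sub1set (subsetP h2) ?(tub_refl t2) in h1.
Qed.

Lemma flat_eq_off x : ~~ (D1 x \subset W) -> D1 x = D2 x.
Proof.
move=> h; have /ffunP/(_ x) := fE; rewrite !ffunE -flat_eq_sub.
by rewrite (negPf h).
Qed.

(** Twins are comparable in both families, so the sets inside [W] are determined by the order of
    each pair of twins. The other sets agree by [flat_eq_off]. *)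
Lemma inversions0 : inversions D1 D2 = set0 -> D1 = D2.
Proof.
move=> /setP I; apply/ffunP=> x.
have [h|/flat_eq_off//] := boolP (D1 x \subset W).
have h' : D2 x \subset W by rewrite -flat_eq_sub.
have xW : x \in W by rewrite (subsetP h) // (tub_refl t1).
have ninv a b : a != b -> b \in D1 a -> a \in D2 b -> False.
  by move=> ab ba ab'; have := I (a, b); rewrite !inE /= ab ba ab'.
apply/setP=> y; have [->|xy] := eqVneq x y; first by rewrite (tub_refl t1) (tub_refl t2).
apply/idP/idP=> yx.
  have yW := subsetP h y yx.
  by case/orP: (twin_comparable t2 xW yW) => // /(ninv x y xy yx).
have yW := subsetP h' y yx.
case/orP: (twin_comparable t1 xW yW) => // xy'.
by case: (ninv y x); rewrite // eq_sym.
Qed.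

(** An inversion with [#|D1 a| - #|D1 b|] minimal is between consecutive twins: for [c] strictly
    between them in [D1], either [(c, b)] or [(a, c)] would be an inversion with a smaller
    difference. *)
Lemma adjacent_inversion : inversions D1 D2 != set0 ->
  exists a b, [/\ (a, b) \in inversions D1 D2, D1 a \subset W &
                  forall c, c \in D1 a -> c != a -> c \in D1 b].
Proof.
case/set0Pn=> p0 Ip0.
case: (@arg_minnP _ p0 (fun p => p \in inversions D1 D2)
  (fun p => #|D1 p.1| - #|D1 p.2|) Ip0) => -[a b] Iab min /=.
have := Iab; rewrite inE /= => /and3P[ab ba ab']; exists a, b.
have aW : D1 a \subset W.
  apply: contraTT isT => /flat_eq_off E; move: ba; rewrite E => ba.
  by rewrite (tub_anti t2 ba ab') eqxx in ab.
split=> // c ca cna; have [->|cb] := eqVneq c b; first exact: (tub_refl t1 b).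
have [bW cW] := (subsetP aW b ba, subsetP aW c ca).
case/orP: (twin_comparable t1 bW cW) => // bc; case: notF.
have lca : #|D1 c| < #|D1 a| by apply: (tub_lt t1 ca); rewrite eq_sym.
have lbc := tub_lt t1 bc cb.
case/orP: (twin_comparable t2 bW cW) => [cb'|bc'].
  have := min (c, b); rewrite inE /= cb bc cb' => /(_ isT).
  by rewrite leqNgt ltn_sub2r // (ltn_trans lbc).
have := min (a, c); rewrite inE /= eq_sym cna ca (tub_trans t2 bc' ab') => /(_ isT).
by rewrite leqNgt ltn_sub2l // (ltn_trans lbc).
Qed.

End Fibre.

Lemma in_tperm a b (A : {set T}) y :
  (a \in A) = (b \in A) -> (tperm a b y \in A) = (y \in A).
Proof. by move=> E; case: tpermP => [->|->|]. Qed.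

(* Two consecutive twins at the bottom of the tree: rotating them has the same
   effect as exchanging their names. *)
Lemma relabel_adjacent D a b : tubing e D -> a != b -> b \in D a ->
    D a \subset W -> (forall c, c \in D a -> c != a -> c \in D b) ->
  [/\ forall z, z != a -> z != b -> relabel a b D z = D z,
      relabel a b D b = D a & flat (relabel a b D) = flat D].
Proof.
move=> tD ab ba aW adj.
have off z : z != a -> z != b -> relabel a b D z = D z.
  move=> za zb; have tz : tperm a b z = z by rewrite tpermD // eq_sym.
  apply/setP=> y; rewrite in_relabel tz.
  apply: in_tperm; apply/idP/idP => [az|bz]; first exact: (tub_trans tD az).
  case/orP: (tub_chain tD bz ba) => // /adj/(_ za) zDb.
  by rewrite (tub_anti tD zDb bz) eqxx in zb.
have top : relabel a b D b = D a.
  apply/setP=> y; rewrite in_relabel tpermR; apply: in_tperm.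
  by rewrite ba (tub_refl tD).
have bW : D b \subset W.
  by apply: subset_trans aW; apply/subsetP=> z; apply: (tub_trans tD).
split=> //; apply/ffunP=> x; rewrite !ffunE -/(relabel a b D).
have [->|xb] := eqVneq x b.
  have := top; rewrite ffunE => ->; by rewrite aW bW.
have [->|xa] := eqVneq x a; last by have := off x xa xb; rewrite ffunE => ->.
rewrite tpermL aW; case: ifPn => // /subsetPn[y]; rewrite inE => yb yW.
have tyW := subsetP bW _ yb; move: yW.
rewrite -(@in_tperm a b) ?tyW // (subsetP aW _ ba) (subsetP aW) //.
exact: (tub_refl tD a).
Qed.

(** * Walks with labelled exchanges of twins *)

(** The label is an unordered pair, so that only ['C(#|W|, 2)] labels are possible. The label [None]
    puts no further condition on the flip. *)
Definition lstep (o : option {set T}) D D' :=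
  [/\ tubing e D, tubing e D', flip D D' &
      if o is Some A then exists a b,
        [/\ a \in W, b \in W, a != b, A = [set a; b] & D' = relabel a b D]
      else True].

(* Walks in the rotation graph of [e]; the label of a step records the pair of
   twins that it exchanges, if it is declared to be such an exchange. *)
Fixpoint lwalk D (ls : seq (option {set T})) D' : Prop :=
  if ls is o :: ls' then exists2 D1, lstep o D D1 & lwalk D1 ls' D' else D = D'.

Lemma lwalk_cat D l1 l2 D' :
  lwalk D (l1 ++ l2) D' <-> exists2 D1, lwalk D l1 D1 & lwalk D1 l2 D'.
Proof.
elim: l1 D => [|o l1 IH] D /=; first by split=> [H|[_ -> //]]; exists D.
split=> [[D1 st /IH[D2 h1 h2]]|[D2 [D1 st h1] h2]].
  by exists D2 => //; exists D1.
by exists D1 => //; apply/IH; exists D2.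
Qed.

Definition plain : pred (option {set T}) := fun o => o == None.

(** Bubble sort: exchanging two consecutive twins that [D2] orders the other way removes an
    inversion and creates none. *)
Lemma fibre_lwalk D1 D2 : tubing e D1 -> tubing e D2 -> flat D1 = flat D2 ->
  exists2 ls, lwalk D1 ls D2 & count plain ls = 0.
Proof.
have [n] := ubnP #|inversions D1 D2|; elim: n D1 => // n IH D1 lt t1 t2 fE.
have [I0|In] := eqVneq (inversions D1 D2) set0.
  by exists [::] => //; apply: inversions0.
have [a [b [Iab aW adj]]] := adjacent_inversion t1 t2 fE In.
move: (Iab); rewrite inE /= => /and3P[ab ba ab'].
have [off top fE'] := relabel_adjacent t1 ab ba aW adj.
set D3 := relabel a b D1 in off top fE'.
have [ainW binW] : a \in W /\ b \in W by rewrite !(subsetP aW) ?(tub_refl t1).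
have t3 : tubing e D3 by apply: relabel_tubing t1; apply: twin_aut.
have nab : a \notin D1 b by apply: contra_neqN ab => ?; apply: (tub_anti t1).
have D3a q : q != a -> q \in D3 a -> q \in D1 b.
  by move=> qa; rewrite in_relabel tpermL; case: tpermP qa => [->|_|//]; rewrite ?eqxx ?(negPf nab).
have [||ls w c0] := IH D3 _ t3 t2; last first.
- exists (Some [set a; b] :: ls); last by rewrite /= c0.
  exists D3 => //; split=> //; last by exists a, b.
  by exists a, b.
- by rewrite fE'.
rewrite ltnS in lt; apply: leq_trans lt; apply: proper_card; apply/properP; split.
  apply/subsetP=> -[p q]; rewrite !inE /= => /and3P[pq qp pq']; rewrite pq pq' andbT.
  have [E|pa] := eqVneq p a.
    rewrite E in pq qp *; apply: (tub_trans t1 ba); apply: D3a => //.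
    by rewrite eq_sym.
  have [E|pb] := eqVneq p b; last by rewrite -off.
  rewrite E in pq qp pq' *; apply: adj; first by rewrite -top.
  by apply: contra_neq ab => qa; apply: (tub_anti t2); rewrite // -qa.
exists (a, b) => //; rewrite inE /= ab /=; apply/negP=> /andP[bD3 _].
have := D3a b; rewrite eq_sym ab bD3 => /(_ isT isT).
by rewrite in_relabel tpermL tpermR (negPf nab) in bD3.
Qed.

(** An exchange of twins is an automorphism of [e], so it carries walks to walks; the labels are
    renamed along with the vertices. *)
Lemma lwalk_relabel a b D ls D' : a \in W -> b \in W -> lwalk D ls D' ->
  exists ls', [/\ lwalk (relabel a b D) ls' (relabel a b D'),
                  size ls' = size ls & count plain ls' = count plain ls].
Proof.
move=> aW bW; elim: ls D => [|o ls IH] D /=; first by move=> ->; exists [::].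
case=> D1 [tD tD1 fl ob] /IH[ls' [w sz ct]].
have tauto := twin_aut aW bW.
have sW c : c \in W -> tperm a b c \in W by case: tpermP => [->|->|].
pose o' := omap (fun A : {set T} => [set tperm a b x | x in A]) o.
exists (o' :: ls'); split; rewrite /= ?sz ?ct //; last by rewrite /o'; case: (o).
exists (relabel a b D1) => //.
split; [exact: relabel_tubing|exact: relabel_tubing|exact: relabel_flip|].
rewrite /o'; case: o ob {o'} => //= A [c [d [cW dW cd -> ->]]].
exists (tperm a b c), (tperm a b d); rewrite !sW //; split=> //.
- by rewrite (inj_eq perm_inj).
- by rewrite imsetU !imset_set1.
- exact: relabel_conj.
Qed.

Lemma repeated_label (ls : seq (option {set T})) : ~~ uniq (pmap id ls) ->
  exists A l1 l2 l3, ls = l1 ++ Some A :: l2 ++ Some A :: l3.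
Proof.
elim: ls => [//|[A|] ls IH] /=; last first.
  by case/IH=> A [l1 [l2 [l3 ->]]]; exists A, (None :: l1), l2, l3.
rewrite negb_and negbK => /orP[|/IH[B [l1 [l2 [l3 ->]]]]]; last first.
  by exists B, (Some A :: l1), l2, l3.
rewrite mem_pmap map_id => /splitPr[l2 l3].
by exists A, [::], l2, l3.
Qed.

(* Exchanging the same twins twice can be avoided by exchanging their names
   along the part of the walk in between. *)
Lemma lwalk_uniq D ls D' : lwalk D ls D' ->
  exists ls', [/\ lwalk D ls' D', count plain ls' = count plain ls
                  & uniq (pmap id ls')].
Proof.
have [n] := ubnP (size ls); elim: n ls => // n IH ls lt w.
have [u|/repeated_label[A [l1 [l2 [l3 E]]]]] := boolP (uniq (pmap id ls)).
  by exists ls.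
rewrite {}E in lt w *; case/lwalk_cat: w => D1 w1 [D2 [_ _ _ [a [b [aW bW ab EA E2]]]]].
case/lwalk_cat=> D3 w2 [D4 [_ _ _ [c [d [_ _ cd EA' E4]]]] w3].
have {}E4 : D4 = relabel a b D3.
  have /set2P hc : c \in [set a; b] by rewrite -EA EA' set21.
  have /set2P hd : d \in [set a; b] by rewrite -EA EA' set22.
  case: hc hd cd E4 => -> [] -> //; rewrite ?eqxx // => _ ->.
  exact: relabelC.
have [l2' [w2' sz ct]] := lwalk_relabel aW bW w2.
rewrite E2 relabelK -E4 in w2'.
have w : lwalk D (l1 ++ l2' ++ l3) D'.
  by apply/lwalk_cat; exists D1 => //; apply/lwalk_cat; exists D4.
have [|ls' [w' ct' u]] := IH _ _ w.
  rewrite ltnS in lt; apply: leq_trans lt.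
  by rewrite !size_cat /= size_cat /= sz !addnS ltnW.
by exists ls'; split; rewrite // ct' !count_cat /= count_cat /= ct.
Qed.

Lemma lwalk_labels D ls D' A : lwalk D ls D' -> A \in pmap id ls ->
  (A \subset W) && (#|A| == 2).
Proof.
elim: ls D => [//|[B|] ls IH] D /= [D1 [_ _ _ ob] w]; last exact: IH w.
rewrite inE => /predU1P[->|]; last exact: IH w.
case: ob => a [b [aW bW ab -> _]]; rewrite cards2 ab andbT.
by apply/subsetP=> z /set2P[] ->.
Qed.

Lemma size_labels (ls : seq (option {set T})) :
  size ls = count plain ls + size (pmap id ls).
Proof. by elim: ls => [//|[A|] ls /= ->]; rewrite ?addnS. Qed.

(** Distinct labels are distinct two-element subsets of [W], which bounds the number of labelled
    steps. *)
Lemma lwalk_short D ls D' : lwalk D ls D' ->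
  exists2 ls', lwalk D ls' D' & size ls' <= count plain ls + 'C(#|W|, 2).
Proof.
case/lwalk_uniq=> ls' [w <- u]; exists ls' => //.
rewrite size_labels leq_add2l -cards_draws cardE.
apply: uniq_leq_size => // A Als; rewrite mem_enum inE.
exact: (lwalk_labels w Als).
Qed.

(** * Preimages under the projection *)

Section Lift.
Variables (D : {ffun T -> {set T}}) (r : T -> nat).
Hypothesis tD : tubing e' D.

(** When [D] is the projection of a tubing, these are the vertices whose subtree in that tubing lies
    inside [W]. *)
Definition leaf_twins := [set x in W | D x == [set x]].

Definition lift : {ffun T -> {set T}} :=
  [ffun x => if x \in leaf_twins then [set y in leaf_twins | r x <= r y] else D x].

(** [D x] is connected for [e'] and [W] is independent there, so from [y] the set can only continue
    to a neighbour outside [W]. *)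
Lemma twin_exit x y : y \in W -> y \in D x -> D x != [set y] ->
  exists n, [/\ n \in D x, n \notin W & e y n].
Proof.
move=> yW yx; rewrite eqEsubset sub1set yx andbT => /subsetPn[z zx zy].
have [a [n [/setIP[_ /set1P->] /setDP[nx _] eyn]]] :=
  conn_in_crossing (tub_conn tD x) yx zx (set11 y) zy.
exists n; split=> //; first exact: (del_indep eyn yW).
by case/andP: eyn.
Qed.

Lemma leaf_twin_below n x : x \in leaf_twins -> n \notin W -> e x n -> x \in D n.
Proof.
rewrite inE => /andP[xW /eqP Dx] nW exn.
rewrite -del_notin // in exn; case/orP: (tub_edge tD exn) => //.
by rewrite Dx => /set1P E; rewrite E xW in nW.
Qed.

Lemma twin_adj a b n : a \in W -> b \in W -> n \notin W -> e a n -> e b n.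
Proof.
by move=> aW bW nW; rewrite (@twin_nbr a b) //; apply: contraNneq nW => ->.
Qed.

(** Some neighbour [n] of [y] in [D x] is outside [W], hence adjacent to the twin [z] as well; as
    [z] is a leaf, it is below [n]. So all leaf twins hang under the same vertices and can be merged
    into one chain. *)
Lemma leaf_twins_below x y z : x \notin leaf_twins -> y \in leaf_twins ->
  z \in leaf_twins -> y \in D x -> z \in D x.
Proof.
move=> nx yl zl yx; have /setIdP[yW /eqP Dy] := yl; have /setIdP[zW _] := zl.
have nxy : D x != [set y].
  apply: contraNneq nx => E; have := tub_refl tD x.
  by rewrite E => /set1P->.
have [n [nx' nW eyn]] := twin_exit yW yx nxy.
by apply: (tub_trans tD nx'); apply: leaf_twin_below => //; apply: twin_adj eyn.
Qed.

Lemma sub_lift x y : y \in D x -> y \in lift x.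
Proof.
rewrite ffunE; case: ifP => // xl; have /setIdP[_ /eqP->] := xl.
by move=> /set1P->; rewrite inE xl leqnn.
Qed.

Hypothesis r_inj : {in leaf_twins &, injective r}.

Lemma lift_tubing : tubing e lift.
Proof.
have liftN x y : x \notin leaf_twins -> (y \in lift x) = (y \in D x).
  by move=> nx; rewrite ffunE (negPf nx).
have liftL x y : x \in leaf_twins -> (y \in lift x) = (y \in leaf_twins) && (r x <= r y).
  by move=> nx; rewrite ffunE nx inE.
split.
- by move=> x; apply: sub_lift; apply: (tub_refl tD).
- move=> x y z; have [xl|xl] := boolP (x \in leaf_twins).
    rewrite !(liftL x) // => /andP[yl xy]; rewrite liftL // => /andP[-> yz].
    exact: leq_trans yz.
  rewrite !(liftN x) // => yx; have [yl|yl] := boolP (y \in leaf_twins).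
    by rewrite liftL // => /andP[zl _]; apply: leaf_twins_below yx.
  by rewrite liftN //; apply: (tub_trans tD).
- move=> x y; have [xl|xl] := boolP (x \in leaf_twins).
    rewrite liftL // => /andP[yl xy]; rewrite liftL // => /andP[_ yx].
    by apply: r_inj => //; apply/eqP; rewrite eqn_leq xy.
  rewrite liftN // => yx; have [yl|yl] := boolP (y \in leaf_twins).
    by rewrite liftL // (negPf xl).
  by rewrite liftN //; apply: (tub_anti tD).
- move=> x y z; have [xl|xl] := boolP (x \in leaf_twins);
    have [yl|yl] := boolP (y \in leaf_twins).
  + by rewrite !liftL // xl yl => _ _; apply: leq_total.
  + rewrite (liftL x z) // !(liftN y) // => /andP[zl _] zy.
    by rewrite (@leaf_twins_below y z x) ?orbT.
  + rewrite !(liftN x) // (liftL y z) // => zx /andP[zl _].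
    by rewrite (@leaf_twins_below x z y).
  + by rewrite !liftN //; apply: (tub_chain tD).
- move=> x y exy; have [e'xy|] := boolP (e' x y).
    by case/orP: (tub_edge tD e'xy) => /sub_lift->; rewrite ?orbT.
  (* A deleted edge: its ends are twins, made comparable by the new chain or by a common neighbour
     outside [W]. *)
  rewrite /e' /del_edges_in /= exy negbK => /andP[xW yW].
  have bound a : a \in W -> a \notin leaf_twins ->
      exists n, [/\ n \in D a, n \notin W & e a n].
    move=> aW; rewrite inE aW /= => Da.
    exact: (twin_exit aW (tub_refl tD a) Da).
  have below a b : a \in leaf_twins -> b \in W -> b \notin leaf_twins -> a \in lift b.
    move=> al bW bl; have [n [nb nW ebn]] := bound b bW bl.
    have /setIdP[aW _] := al; rewrite liftN //; apply: (tub_trans tD nb).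
    by apply: leaf_twin_below => //; apply: twin_adj ebn.
  have [xl|xl] := boolP (x \in leaf_twins);
    have [yl|yl] := boolP (y \in leaf_twins).
  + by rewrite !liftL // xl yl; apply: leq_total.
  + by rewrite (below x y) ?orbT.
  + by rewrite (below y x).
  + rewrite !liftN //; have [n [ny nW eyn]] := bound y yW yl.
    have exn : e' x n by rewrite del_notin //; apply: twin_adj eyn.
    case/orP: (tub_edge tD exn) => [nx|xn]; last by rewrite (tub_trans tD ny xn) orbT.
    exact: (tub_chain tD nx ny).
- move=> x; have [xl|xl] := boolP (x \in leaf_twins); last first.
    rewrite ffunE (negPf xl); apply: conn_in_sub (tub_conn tD x).
    by move=> a b /andP[].
  rewrite ffunE xl; apply/forall_inP=> a aA; apply/forall_inP=> b bA.
  have [->|ab] := eqVneq a b; first exact: connect0.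
  apply: connect1; rewrite /rel_in /= aA bA.
  case/setIdP: aA => /setIdP[aW _] _; case/setIdP: bA => /setIdP[bW _] _.
  by rewrite twin_edge.
Qed.

Lemma flat_lift : flat lift = D.
Proof.
apply/ffunP=> x; rewrite ffunE [lift x]ffunE.
have [xl|xl] := boolP (x \in leaf_twins).
  have /setIdP[_ /eqP->] := xl.
  by case: ifPn => // /subsetPn[y] /setIdP[/setIdP[->]].
case: ifP => // /subsetP h; have xW := h x (tub_refl tD x).
move: xl; rewrite inE xW /= => Dx.
by have [n [/h->]] := twin_exit xW (tub_refl tD x) Dx.
Qed.

End Lift.

(* Ranking [u] and [v] below everything else makes the lifts of both ends of
   the flip agree on the remaining leaf twins. *)
Lemma lift_flip D D' : tubing e' D -> tubing e' D' -> flip D D' ->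
  exists D1 D1', [/\ tubing e D1, tubing e D1', flat D1 = D, flat D1' = D'
                     & flip D1 D1'].
Proof.
move=> tD tD' [u [v [uv off vu]]].
(* The common rank 0 does not spoil injectivity: the set [D u], equal to [D' v], contains both [u]
   and [v], so [u] is no leaf twin of [D] and [v] none of [D']. *)
pose r z := if (z == u) || (z == v) then 0 else (enum_rank z).+1.
have nuD : u \notin leaf_twins D.
  rewrite inE negb_and; apply/orP; right; apply: contra_neqN uv => /eqP E.
  by have := tub_refl tD' v; rewrite vu E => /set1P.
have nvD' : v \notin leaf_twins D'.
  rewrite inE negb_and; apply/orP; right; apply: contra_neqN uv => /eqP E.
  by have := tub_refl tD u; rewrite -vu E => /set1P.
have leafE z : z != u -> z != v -> (z \in leaf_twins D') = (z \in leaf_twins D).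
  by move=> zu zv; rewrite !inE off.
have inj1 : {in leaf_twins D &, injective r}.
  move=> x y xl yl; rewrite /r.
  have -> : x == u = false by apply: contraNF nuD => /eqP<-.
  have -> : y == u = false by apply: contraNF nuD => /eqP<-.
  case: eqVneq => [->|_] /=; case: eqVneq => [->|_] //= [].
  by move/ord_inj/enum_rank_inj.
have inj2 : {in leaf_twins D' &, injective r}.
  move=> x y xl yl; rewrite /r ![_ || (_ == v)]orbC.
  have -> : x == v = false by apply: contraNF nvD' => /eqP<-.
  have -> : y == v = false by apply: contraNF nvD' => /eqP<-.
  case: eqVneq => [->|_] /=; case: eqVneq => [->|_] //= [].
  by move/ord_inj/enum_rank_inj.
exists (lift D r), (lift D' r); split.
- exact: lift_tubing.
- exact: lift_tubing.
- exact: flat_lift.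
- exact: flat_lift.
exists u, v; split=> // [z zu zv|]; last by rewrite !ffunE (negPf nuD) (negPf nvD').
rewrite !ffunE leafE // off //; case: ifP => // zl; apply/setP=> y; rewrite !in_set.
have [->|yu] := eqVneq y u; first by rewrite /r (negPf zu) (negPf zv) eqxx !andbF.
have [->|yv] := eqVneq y v; first by rewrite /r (negPf zu) (negPf zv) eqxx orbT !andbF.
by have := leafE y yu yv; rewrite !in_set => ->.
Qed.

(** * Lifting walks to the rotation graph of [e] *)

(** Each step lifts by [lift_flip] to one unlabelled flip. Consecutive lifts, and the prescribed
    ends [D] and [D'], are joined inside fibres by [fibre_lwalk], which uses labelled steps only. *)
Lemma walk_lift n t t' D D' :
    walk (RG_vertices e') (RG_adj e') n t t' ->
    t \in RG_vertices e' -> tubing e D -> tubing e D' ->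
    flat D = desc t -> flat D' = desc t' ->
  exists2 ls, lwalk D ls D' & count plain ls = n.
Proof.
elim: n t D => [|n IH] t D /=.
  by move=> /eqP-> _ tD tD' E E'; apply: fibre_lwalk; rewrite // E.
case/existsP=> z /and3P[zV adj w] tV tD tD' E E'.
have fl := RG_adj_flip del_sym adj.
move: (zV) (tV); rewrite !inE => sz st.
have [tz _] := search_forest_tubing del_sym sz.
have [tt _] := search_forest_tubing del_sym st.
have [D1 [D2 [t1 t2 f1 f2 fl12]]] := lift_flip tt tz fl.
have [l1 w1 c1] := fibre_lwalk tD t1 (etrans E (esym f1)).
have [l2 w2 c2] := IH z D2 w zV t2 tD' f2 E'.
exists (l1 ++ None :: l2); last by rewrite count_cat /= c1 c2.
by apply/lwalk_cat; exists D1 => //; exists D2.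
Qed.

Lemma lwalk_walk ls t t' : search_forest e t -> search_forest e t' ->
  lwalk (desc t) ls (desc t') ->
  walk (RG_vertices e) (RG_adj e) (size ls) t t'.
Proof.
elim: ls t => [|o ls IH] t st st' /=.
  have [tt lt] := search_forest_tubing es st.
  have [_ lt'] := search_forest_tubing es st'.
  by move=> E; apply/eqP; apply: (par_inj tt).
case=> D [_ tD fl _] w; have sz := tubing_search_forest es tD.
have dz := desc_par_of tD.
apply/existsP; exists (par_of D); rewrite inE sz /= IH ?dz // andbT.
by apply: flip_RG_adj; rewrite ?dz.
Qed.

End Twins.
End Tubings.

(** * Distances and the inequality of diameters *)

(** [find] returns the length of the list when it finds nothing, so [#|F|] is both the default value
    and an upper bound. *)
Lemma dist_max (F : finType) (V : {set F}) adj x y : dist V adj x y <= #|F|.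
Proof. by apply: leq_trans (find_size _ _) _; rewrite size_iota. Qed.

Lemma walk_dist (F : finType) (V : {set F}) adj n x y :
  walk V adj n x y -> dist V adj x y <= n.
Proof.
move=> w; have [lt|ge] := ltnP n #|F|; last exact: leq_trans (dist_max _ _ _ _) ge.
rewrite leqNgt; apply/negP=> /(before_find 0).
by rewrite nth_iota // add0n w.
Qed.

(** A value below [#|F|] is not the default of [find], so a walk attains it. *)
Lemma dist_walk (F : finType) (V : {set F}) adj x y :
  dist V adj x y < #|F| -> walk V adj (dist V adj x y) x y.
Proof.
rewrite /dist => lt; have := lt; rewrite -{2}(size_iota 0 #|F|) -has_find.
by move=> /(nth_find 0); rewrite nth_iota.
Qed.

Lemma dist_diam (F : finType) (V : {set F}) adj x y :
  x \in V -> y \in V -> dist V adj x y <= diam V adj.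
Proof.
move=> xV yV; apply: leq_trans (leq_bigmax_cond _ xV).
exact: leq_bigmax_cond.
Qed.

Theorem theorem4p7 (T : finType) (e : rel T) :
  symmetric e -> irreflexive e -> connected_graph e ->
  forall W : {set T}, 2 <= #|W| ->
  (forall u v, u \in W -> v \in W -> true_twins e u v) ->
  rot_diam e - 'C(#|W|, 2) <= rot_diam (del_edges_in e W).
Proof.
move=> es ei _ W _ tw; rewrite leq_subLR addnC; set e' := del_edges_in e W.
apply/bigmax_leqP=> x xV; apply/bigmax_leqP=> y yV.
have es' : symmetric e' := del_sym W es.
have [tx _] : tubing e (desc x) /\ loopless x.
  by apply: search_forest_tubing => //; rewrite inE in xV.
have [ty _] : tubing e (desc y) /\ loopless y.
  by apply: search_forest_tubing => //; rewrite inE in yV.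
have fx := flat_tubing es tw tx; have fy := flat_tubing es tw ty.
pose x' := par_of (flat W (desc x)); pose y' := par_of (flat W (desc y)).
have x'V : x' \in RG_vertices e' by rewrite inE; apply: tubing_search_forest.
have y'V : y' \in RG_vertices e' by rewrite inE; apply: tubing_search_forest.
apply: leq_trans (leq_add (dist_diam (RG_adj e') x'V y'V) (leqnn _)).
(* An unreachable pair has distance [#|F|], which bounds every distance. *)
have [lt|ge] := ltnP (dist (RG_vertices e') (RG_adj e') x' y') #|{ffun T -> option T}|; last first.
  exact: leq_trans (dist_max _ _ _ _) (leq_trans ge (leq_addr _ _)).
have [||ls w ct] := walk_lift es ei tw (dist_walk lt) x'V tx ty.
- by rewrite (desc_par_of fx).
- by rewrite (desc_par_of fy).
have [ls' w' sz] := lwalk_short es ei tw w; rewrite ct in sz.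
apply: leq_trans sz; apply: walk_dist; rewrite !inE in xV yV.
exact: lwalk_walk w'.
Qed.
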